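(* Let $h\in C^0[0,\infty)$ satisfy $h(r)\le 0$ for all $r>0$, and consider (this is the case of dimension $n=4$) the equation $$u''(r)+\frac{3}{r}u'(r)-2u(r)^3-\frac{6}{r}u(r)^2-\frac{3}{r^2}u(r)=\left[u'(r)+\frac{u(r)}{r}\right]h(r).$$ Then this equation admits infinitely many negative global solutions. More precisely, for any $\alpha<0$ the solution $u$ of this equation with initial conditions $u(0)=0$, $u'(0)=\alpha$ is global and it satisfies $-\frac{2}{r}<u(r)<0$ for all $r>0$.
   Context: A solution of the initial value problem on an interval $[0,T)$, $0<T\le\infty$, is a function $u\in C^2[0,T)$ satisfying the equation for $r\in(0,T)$ and the initial conditions at $r=0$ (the equation is singular at $r=0$, but for $C^2$ functions with $u(0)=0$ its terms suitably combined have finite limits as $r\to0$). The problem has a local solution, unique as long as it can be continued. A solution is global if it is defined on all of $[0,\infty)$. *)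

(* Defs.v *)
From Stdlib Require Import Reals.
From Coquelicot Require Import Coquelicot.
Open Scope R_scope.

Definition ico (T : Rbar) (r : R) : Prop := 0 <= r /\ Rbar_lt r T.

(* Limits are taken within [D], so at an endpoint of [D] continuity and
   derivatives are one-sided and values outside [D] are irrelevant. *)
Definition C0_on (D : R -> Prop) (f : R -> R) : Prop :=
  forall x, D x -> continue_in f D x.

Definition derivative_on (D : R -> Prop) (f f' : R -> R) : Prop :=
  forall x, D x -> D_in f f' D x.

Definition C2_on (D : R -> Prop) (u u' u'' : R -> R) : Prop :=
  derivative_on D u u' /\ derivative_on D u' u'' /\ C0_on D u''.

Definition equation_at (h u u' u'' : R -> R) (r : R) : Prop :=
  u'' r + 3 / r * u' r - 2 * u r ^ 3 - 6 / r * u r ^ 2 - 3 / r ^ 2 * u r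
  = (u' r + u r / r) * h r.

(* [u : R -> R] matters only through its restriction to [0,T); the derivatives
   are determined by it there. *)
Definition solution (h : R -> R) (alpha : R) (T : Rbar) (u : R -> R) : Prop :=
  Rbar_lt 0 T /\
  exists u' u'' : R -> R,
    C2_on (ico T) u u' u'' /\
    (forall r : R, 0 < r -> Rbar_lt r T -> equation_at h u u' u'' r) /\
    u 0 = 0 /\ u' 0 = alpha.

Definition global_solution (h : R -> R) (alpha : R) (u : R -> R) : Prop :=
  solution h alpha p_infty u.

Definition negative_global_solution (h : R -> R) (u : R -> R) : Prop :=
  (exists alpha : R, global_solution h alpha u) /\
  forall r : R, 0 < r -> u r < 0.

(* [u] is global and every solution on some [0,T) is a restriction of it. *)
Definition is_the_global_solution (h : R -> R) (alpha : R) (u : R -> R) : Prop :=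
  global_solution h alpha u /\
  forall (T : Rbar) (v : R -> R),
    solution h alpha T v -> forall r : R, ico T r -> v r = u r.

(* Main.v *)
Require Import Defs.
From Stdlib Require Import Reals Lra Lia ClassicalEpsilon.
From Coquelicot Require Import Coquelicot.
Open Scope R_scope.

(** Put [v = r u] and [t = ln r]. The equation becomes autonomous up to the
    friction term, [v_tt = 2 v (v + 1) (v + 2) + r h v_t], a particle in a
    potential with equilibria at [v = 0] and [v = -2], which starts at 0 for
    [t -> -oo] with zero energy [v_t ^ 2 - (v (v + 2)) ^ 2]. As [h <= 0] the
    energy decreases, so [|v_t| <= |v| |v + 2|] ([slope_bound]); by Gronwall such
    a [v] reaches neither equilibrium in finite time. Hence [-2 < v < 0], which
    is the bound claimed for [u], and [v_t >= v (v + 2)], which says that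
    [z = u / r] is nondecreasing, so that [alpha <= z < 0]
    ([invariant_region]).

    The singularity at the origin is removed by the unknowns [z = u / r] and
    [p = z']: the equation is [r p' + 5 p = F(r, z, p)], that is
    [p(r) = r ^ -5] times the integral of [s ^ 4 F] over [0, r], and [F] is
    Lipschitz with a constant that in [p] is of order [r]. Picard iteration then
    converges on the whole half-line if [F] is globally Lipschitz in [z]
    ([singular_ode_solvable]). The nonlinearity is cubic, but by the a priori
    bound it may be truncated to a bounded range of [z] without changing the
    solution ([reduced_global]); no continuation argument is required.

    For uniqueness, the differences [D] of [z] and [q] of [p] satisfy
    [E' <= C E] for [E = D ^ 2 + r q ^ 2], and [E] tends to 0 at the origin
    ([solution_unique]). Solutions with different slopes at 0 differ, which
    gives infinitely many. *)

(** * Calculus on the line and on the half-line *)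

Lemma cpt_plus (f g : R -> R) (x : R) :
  continuity_pt f x -> continuity_pt g x ->
  continuity_pt (fun y => f y + g y) x.
Proof. exact (continuity_pt_plus f g x). Qed.

Lemma cpt_minus (f g : R -> R) (x : R) :
  continuity_pt f x -> continuity_pt g x ->
  continuity_pt (fun y => f y - g y) x.
Proof. exact (continuity_pt_minus f g x). Qed.

Lemma cpt_mult (f g : R -> R) (x : R) :
  continuity_pt f x -> continuity_pt g x ->
  continuity_pt (fun y => f y * g y) x.
Proof. exact (continuity_pt_mult f g x). Qed.

Lemma cpt_pow (f : R -> R) (n : nat) (x : R) :
  continuity_pt f x -> continuity_pt (fun y => f y ^ n) x.
Proof.
  intros H; induction n as [|n IH]; simpl.
  - apply continuity_pt_const; intros a b; reflexivity.
  - now apply cpt_mult.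
Qed.

Lemma cpt_const (c x : R) : continuity_pt (fun _ => c) x.
Proof. apply continuity_pt_const; intros a b; reflexivity. Qed.

Lemma cpt_id (x : R) : continuity_pt (fun y => y) x.
Proof. exact (continuity_pt_id x). Qed.

Ltac cpt :=
  repeat (assumption || apply cpt_const || apply cpt_id || apply cpt_pow
          || apply cpt_minus || apply cpt_plus || apply cpt_mult).

Lemma cpt_eps (f : R -> R) (x : R) :
  continuity_pt f x <->
  (forall eps, 0 < eps -> exists d, 0 < d /\
     forall y, Rabs (y - x) < d -> Rabs (f y - f x) < eps).
Proof.
  rewrite continuity_pt_locally; split.
  - intros H eps he; destruct (H (mkposreal eps he)) as [d Hd].
    exists d; split; [apply cond_pos | intros y hy; exact (Hd y hy)].
  - intros H [eps he]; destruct (H eps he) as [d [hd Hd]].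
    exists (mkposreal d hd); intros y hy; exact (Hd y hy).
Qed.

Lemma is_derive_cpt (f : R -> R) (x l : R) :
  is_derive f x l -> continuity_pt f x.
Proof.
  intros H; apply continuity_pt_filterlim.
  apply (ex_derive_continuous (K := R_AbsRing) (V := R_NormedModule)).
  now exists l.
Qed.

Lemma locally_above (a r : R) : a < r -> locally r (fun s => a < s).
Proof. exact (open_gt a r). Qed.

Lemma cpt_bounded (f : R -> R) (a b : R) :
  (forall x, a <= x <= b -> continuity_pt f x) ->
  exists M, 0 < M /\ forall x, a <= x <= b -> Rabs (f x) <= M.
Proof.
  intros H.
  destruct (bounded_continuity (K := R_AbsRing) (V := R_NormedModule) f a b)
    as [M HM].
  - intros y hy; apply continuity_pt_filterlim; auto.
  - exists (Rmax M 1); split.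
    + apply Rlt_le_trans with 1; [lra | apply Rmax_r].
    + intros x hx; apply Rle_trans with M; [|apply Rmax_l].
      left; exact (HM x hx).
Qed.

Lemma nonincreasing_of_derive (f f' : R -> R) (a b : R) :
  a <= b ->
  (forall x, a <= x <= b -> continuity_pt f x) ->
  (forall x, a < x < b -> is_derive f x (f' x)) ->
  (forall x, a < x < b -> f' x <= 0) ->
  f b <= f a.
Proof.
  intros hab hc hd hs.
  destruct (Req_dec a b) as [->|hne]; [lra|].
  assert (pr : forall c, a < c < b -> derivable_pt f c).
  { intros c hc'; exists (f' c); apply is_derive_Reals; auto. }
  assert (pr2 : forall c, a < c < b -> derivable_pt id c).
  { intros c _; apply derivable_pt_id. }
  destruct (MVT f id a b pr pr2) as [c [P Hc]]; try lra; auto.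
  { intros c _; apply derivable_continuous_pt, derivable_pt_id. }
  assert (E1 : derive_pt f c (pr c P) = f' c).
  { apply derive_pt_eq, is_derive_Reals; auto. }
  assert (E2 : derive_pt id c (pr2 c P) = 1).
  { apply derive_pt_eq, derivable_pt_lim_id. }
  rewrite E1, E2 in Hc; unfold id in Hc.
  specialize (hs c P); nra.
Qed.

Lemma increment_le_of_derive (f f' g g' : R -> R) (a b : R) :
  a <= b ->
  (forall x, a <= x <= b -> continuity_pt f x) ->
  (forall x, a <= x <= b -> continuity_pt g x) ->
  (forall x, a < x < b -> is_derive f x (f' x)) ->
  (forall x, a < x < b -> is_derive g x (g' x)) ->
  (forall x, a < x < b -> Rabs (f' x) <= g' x) ->
  Rabs (f b - f a) <= g b - g a.
Proof.
  intros hab cf cg df dg hle.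
  assert (H1 : f b - g b <= f a - g a).
  { apply (nonincreasing_of_derive (fun x => f x - g x) (fun x => f' x - g' x));
      auto.
    - intros y hy; cpt; auto.
    - intros x hx; apply (is_derive_minus f g); auto.
    - intros x hx; generalize (hle x hx) (Rle_abs (f' x)); lra. }
  assert (H2 : - f b - g b <= - f a - g a).
  { apply (nonincreasing_of_derive (fun x => - f x - g x)
             (fun x => - f' x - g' x)); auto.
    - intros x hx; apply (cpt_minus (fun y => - f y)); auto.
      apply (continuity_pt_opp f); auto.
    - intros x hx; apply (is_derive_minus (fun y => - f y) g); auto.
      apply (is_derive_opp f); auto.
    - intros x hx; generalize (hle x hx) (Rle_abs (- f' x)).
      rewrite Rabs_Ropp; lra. }
  apply Rabs_le; lra.
Qed.

(** Gronwall run backwards: [g ^ 2] times an exponential is nondecreasing, so a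
    quantity with [|g'| <= C |g|] that vanishes at [b] vanishes before [b]. *)
Lemma vanishes_before (g g' : R -> R) (C a b : R) :
  a <= b ->
  (forall x, a <= x <= b -> is_derive g x (g' x)) ->
  (forall x, a < x < b -> Rabs (g' x) <= C * Rabs (g x)) ->
  g b = 0 -> g a = 0.
Proof.
  intros hab dg hle hb.
  assert (dE : forall x, a <= x <= b ->
    is_derive (fun y => - (g y ^ 2 * exp (2 * C * y))) x
      (- ((2 * g x * g' x + 2 * C * g x ^ 2) * exp (2 * C * x)))).
  { intros x hx; assert (dx := dg x hx).
    auto_derive; [now exists (g' x)|].
    replace (Derive (fun y : R => g y) x) with (g' x)
      by (symmetry; exact (is_derive_unique g x _ dx)).
    ring. }
  assert (H : - (g b ^ 2 * exp (2 * C * b)) <= - (g a ^ 2 * exp (2 * C * a))).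
  { apply (nonincreasing_of_derive (fun x => - (g x ^ 2 * exp (2 * C * x)))
      (fun x => - ((2 * g x * g' x + 2 * C * g x ^ 2) * exp (2 * C * x)))); auto.
    - intros x hx; exact (is_derive_cpt _ _ _ (dE x hx)).
    - intros x hx; apply dE; lra.
    - intros x hx; specialize (hle x hx).
      assert (0 <= 2 * g x * g' x + 2 * C * g x ^ 2).
      { assert (- (g x * g' x) <= Rabs (g x) * Rabs (g' x)).
        { rewrite <- Rabs_mult, <- Rabs_Ropp; apply Rle_abs. }
        replace (g x ^ 2) with (Rabs (g x) * Rabs (g x))
          by (rewrite <- pow2_abs; ring).
        assert (Rabs (g' x) * Rabs (g x) <= C * Rabs (g x) * Rabs (g x))
          by (apply Rmult_le_compat_r; [apply Rabs_pos | exact hle]).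
        lra. }
      generalize (exp_pos (2 * C * x)); nra. }
  rewrite hb in H.
  generalize (exp_pos (2 * C * a)); intros he.
  assert (g a ^ 2 <= 0) by nra.
  nra.
Qed.

(** The exit-time argument: the supremum of the times up to which [g] stays
    positive is a zero of [g]. *)
Lemma first_zero (g : R -> R) (b : R) :
  (forall x, 0 <= x <= b -> continuity_pt g x) ->
  0 < g 0 -> 0 <= b -> g b <= 0 ->
  exists c, 0 < c <= b /\ g c = 0 /\ forall x, 0 <= x < c -> 0 < g x.
Proof.
  intros hc h0 hb hgb.
  set (E := fun x => 0 <= x <= b /\ forall y, 0 <= y <= x -> 0 < g y).
  destruct (completeness E) as [c [ub lub]].
  { exists b; intros x [hx _]; lra. }
  { exists 0; split; [lra|]; intros y hy; replace y with 0 by lra; auto. }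
  assert (c0 : 0 <= c).
  { apply ub; split; [lra|]; intros y hy; replace y with 0 by lra; auto. }
  assert (cb : c <= b) by (apply lub; intros x [hx _]; lra).
  assert (pos : forall x, 0 <= x < c -> 0 < g x).
  { intros x hx.
    destruct (Rlt_le_dec 0 (g x)) as [|hn]; auto.
    assert (c <= x); [|lra].
    apply lub; intros y [hy1 hy2].
    destruct (Rle_lt_dec y x); auto.
    specialize (hy2 x ltac:(lra)); lra. }
  assert (ec : g c = 0).
  { destruct (Rtotal_order (g c) 0) as [hl|[|hg]]; auto; exfalso.
    - destruct (proj1 (cpt_eps g c) (hc c ltac:(lra)) (- g c) ltac:(lra))
        as [d [hd Hd]].
      assert (0 < c) by (destruct c0; auto; subst; lra).
      specialize (Hd (Rmax (c / 2) (c - d / 2))).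
      assert (c / 2 <= Rmax (c / 2) (c - d / 2)) by apply Rmax_l.
      assert (c - d / 2 <= Rmax (c / 2) (c - d / 2)) by apply Rmax_r.
      assert (Rmax (c / 2) (c - d / 2) < c) by (apply Rmax_lub_lt; lra).
      specialize (pos (Rmax (c / 2) (c - d / 2)) ltac:(lra)).
      assert (h : Rabs (Rmax (c / 2) (c - d / 2) - c) < d)
        by (apply Rabs_lt_between; lra).
      apply Hd in h; apply Rabs_lt_between in h; lra.
    - destruct (proj1 (cpt_eps g c) (hc c ltac:(lra)) (g c) hg) as [d [hd Hd]].
      assert (c < b) by (destruct cb; auto; subst; lra).
      assert (Rmin b (c + d / 2) <= c).
      { apply ub; split.
        - split; [apply Rmin_glb; lra | apply Rmin_l].
        - intros y hy.
          assert (y <= c + d / 2)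
            by (apply Rle_trans with (1 := proj2 hy); apply Rmin_r).
          destruct (Rlt_le_dec y c); [apply pos; lra|].
          assert (h : Rabs (y - c) < d) by (apply Rabs_lt_between; lra).
          apply Hd in h; apply Rabs_lt_between in h; lra. }
      assert (c < Rmin b (c + d / 2)) by (apply Rmin_glb_lt; lra).
      lra. }
  exists c; repeat split; auto.
  destruct c0 as [|<-]; auto; lra.
Qed.

Lemma Rmax_near (x : R) :
  forall y, Rabs (Rmax 0 y - Rmax 0 x) <= Rabs (y - x).
Proof.
  intros y; unfold Rmax, Rabs.
  repeat destruct Rle_dec; repeat destruct Rcase_abs; lra.
Qed.

(** Constant extension to the left of 0 turns one-sided continuity at the
    endpoint into continuity on a full neighbourhood. *)
Lemma cpt_half_line (T : Rbar) (f : R -> R) (x : R) :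
  Rbar_lt 0 T -> C0_on (ico T) f -> Rbar_lt x T ->
  continuity_pt (fun y => f (Rmax 0 y)) x.
Proof.
  intros hT hf hx.
  assert (hD : forall y : R, Rbar_lt y T -> ico T (Rmax 0 y)).
  { intros y hy; split; [apply Rmax_l|].
    destruct (Rle_dec 0 y); [rewrite Rmax_right | rewrite Rmax_left];
      auto; lra. }
  assert (near : exists d, 0 < d /\ forall y, Rabs (y - x) < d -> Rbar_lt (Finite y) T).
  { destruct T as [t| |]; simpl in *; try contradiction.
    - exists (t - x); split; [lra|]; intros y hy.
      apply Rabs_lt_between in hy; lra.
    - exists 1; split; [lra|auto]. }
  destruct near as [d0 [hd0 near]].
  apply cpt_eps; intros eps he.
  destruct (hf _ (hD x hx) eps he) as [d [hd Hd]].
  exists (Rmin d0 d); split; [apply Rmin_glb_lt; lra|]; intros y hy.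
  destruct (Req_dec (Rmax 0 y) (Rmax 0 x)) as [e|ne].
  - rewrite e, Rminus_diag, Rabs_R0; auto.
  - apply (Hd (Rmax 0 y)); split; [split|].
    + apply hD, near; apply Rlt_le_trans with (1 := hy), Rmin_l.
    + now apply not_eq_sym.
    + apply Rle_lt_trans with (1 := Rmax_near x y).
      apply Rlt_le_trans with (1 := hy), Rmin_r.
Qed.

Lemma derivative_on_interior (T : Rbar) (f f' : R -> R) (r : R) :
  derivative_on (ico T) f f' -> 0 < r -> Rbar_lt r T -> is_derive f r (f' r).
Proof.
  intros H hr hT.
  assert (near : exists d, 0 < d /\ forall y, Rabs (y - r) < d -> ico T y).
  { destruct T as [t| |]; simpl in hT; try contradiction.
    - exists (Rmin r (t - r)); split; [apply Rmin_glb_lt; lra|]; intros y hy.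
      generalize (Rmin_l r (t - r)) (Rmin_r r (t - r)).
      apply Rabs_lt_between in hy; unfold ico; simpl; lra.
    - exists r; split; auto; intros y hy.
      apply Rabs_lt_between in hy; unfold ico; simpl; lra. }
  destruct near as [d0 [hd0 near]].
  apply is_derive_Reals; intros eps he.
  assert (hD : ico T r) by (split; auto; lra).
  destruct (H r hD eps he) as [d [hd Hd]].
  assert (hp : 0 < Rmin d0 d) by (apply Rmin_glb_lt; lra).
  exists (mkposreal _ hp); simpl; intros k hk0 hk.
  specialize (Hd (r + k)); simpl in Hd; unfold Rdist in Hd.
  replace (r + k - r) with k in Hd by ring.
  apply Hd; split; [split|].
  - apply near; replace (r + k - r) with k by ring.
    apply Rlt_le_trans with (1 := hk), Rmin_l.
  - lra.
  - apply Rlt_le_trans with (1 := hk), Rmin_r.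
Qed.

Lemma derivative_on_C0 (D : R -> Prop) (f f' : R -> R) :
  derivative_on D f f' -> C0_on D f.
Proof. intros H x hx; exact (cont_deriv f f' D x (H x hx)). Qed.

Lemma derivative_on_of_is_derive (D : R -> Prop) (f f' : R -> R) :
  (forall x, D x -> is_derive f x (f' x)) -> derivative_on D f f'.
Proof.
  intros H x hx eps he.
  destruct (proj1 (is_derive_Reals f x (f' x)) (H x hx) eps he) as [d Hd].
  exists d; split; [apply cond_pos|]; simpl; unfold Rdist.
  intros y [[_ hne] hy].
  specialize (Hd (y - x) ltac:(lra) hy).
  replace (x + (y - x)) with y in Hd by ring; exact Hd.
Qed.

Lemma C0_on_of_cpt (D : R -> Prop) (f : R -> R) :
  (forall x, D x -> continuity_pt f x) -> C0_on D f.
Proof.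
  intros H x hx eps he.
  destruct (proj1 (cpt_eps f x) (H x hx) eps he) as [d [hd Hd]].
  exists d; split; auto; simpl; unfold Rdist; intros y [_ hy]; auto.
Qed.

(** * Solving a first-order equation that is singular at the origin *)

Definition primitive (f : R -> R) (r : R) : R := RInt f 0 r.

Lemma primitive_0 (f : R -> R) : primitive f 0 = 0.
Proof. exact (RInt_point (V := R_CompleteNormedModule) 0 f). Qed.

Lemma primitive_derive (f : R -> R) (r : R) :
  (forall x, continuity_pt f x) -> is_derive (primitive f) r (f r).
Proof.
  intros hf.
  assert (hc : forall x, continuous f x)
    by (intros x; apply continuity_pt_filterlim, hf).
  apply (is_derive_RInt f (primitive f) 0 r); [|apply hc].
  apply filter_forall; intros x.
  apply (RInt_correct (V := R_CompleteNormedModule)).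
  apply (ex_RInt_continuous (V := R_CompleteNormedModule)); intros; apply hc.
Qed.

(** The solution of [r p' + 5 p = G] that stays bounded at the origin, namely
    [r ^ -5] times the integral of [s ^ 4 G s] over [0, r]: the mean of [G]
    over a ball of dimension 5, up to the factor 5. *)
Definition avg (G : R -> R) (r : R) : R :=
  if Req_dec_T r 0 then G 0 / 5
  else primitive (fun s => s ^ 4 * G s) r / r ^ 5.

Lemma avg_0 (G : R -> R) : avg G 0 = G 0 / 5.
Proof. unfold avg; destruct Req_dec_T; [reflexivity | lra]. Qed.

Lemma avg_ne (G : R -> R) (r : R) : r <> 0 ->
  avg G r = primitive (fun s => s ^ 4 * G s) r / r ^ 5.
Proof. intros hr; unfold avg; destruct Req_dec_T; [lra | reflexivity]. Qed.

Lemma moment_cpt (G : R -> R) :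
  (forall x, continuity_pt G x) ->
  forall x, continuity_pt (fun s => s ^ 4 * G s) x.
Proof. intros hG x; cpt; apply hG. Qed.

Lemma avg_derive (G : R -> R) (r : R) :
  (forall x, continuity_pt G x) -> r <> 0 ->
  is_derive (avg G) r ((G r - 5 * avg G r) / r).
Proof.
  intros hG hr.
  assert (hP := primitive_derive _ r (moment_cpt G hG)).
  rewrite (avg_ne G r hr).
  set (P := primitive (fun s => s ^ 4 * G s)) in *.
  apply (is_derive_ext_loc (fun s => P s / s ^ 5)).
  - assert (hp : 0 < Rabs r) by now apply Rabs_pos_lt.
    exists (mkposreal _ hp); intros y hy.
    symmetry; apply avg_ne; intros ->.
    change (Rabs (0 - r) < Rabs r) in hy.
    rewrite Rminus_0_l, Rabs_Ropp in hy; lra.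
  - auto_derive.
    + split; [now eexists; apply hP|]; split; auto.
      apply (pow_nonzero r 5 hr).
    + replace (Derive (fun y : R => P y) r) with (r ^ 4 * G r)
        by (symmetry; exact (is_derive_unique P r _ hP)).
      field; auto.
Qed.

(** Cauchy's mean value theorem, applied to the primitive of [s ^ 4 G s] and to
    [r ^ 5]. *)
Lemma avg_mean (G : R -> R) (r : R) :
  (forall x, continuity_pt G x) -> r <> 0 ->
  exists c, Rabs c <= Rabs r /\ avg G r = G c / 5.
Proof.
  intros hG hr.
  assert (hP := fun x => primitive_derive _ x (moment_cpt G hG)).
  rewrite (avg_ne G r hr).
  assert (P0 : primitive (fun s => s ^ 4 * G s) 0 = 0) by apply primitive_0.
  set (P := primitive (fun s => s ^ 4 * G s)) in *.
  assert (dP : forall c, derivable_pt P c).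
  { intros c; exists (c ^ 4 * G c); apply is_derive_Reals, hP. }
  assert (dq : forall c, derivable_pt (fun x => x ^ 5) c)
    by (intros c; apply derivable_pt_pow).
  assert (key : forall a b, a < b -> exists c, a < c < b /\
            (b ^ 5 - a ^ 5) * (c ^ 4 * G c) = (P b - P a) * (5 * c ^ 4)).
  { intros a b hab.
    destruct (MVT P (fun x => x ^ 5) a b (fun c _ => dP c) (fun c _ => dq c) hab)
      as [c [hc Hc]].
    - intros c _; apply derivable_continuous_pt, dP.
    - intros c _; apply derivable_continuous_pt, dq.
    - exists c; split; auto.
      assert (E1 : derive_pt P c (dP c) = c ^ 4 * G c).
      { apply derive_pt_eq, is_derive_Reals; auto. }
      assert (E2 : derive_pt (fun x => x ^ 5) c (dq c) = 5 * c ^ 4).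
      { apply derive_pt_eq.
        replace (5 * c ^ 4) with (INR 5 * c ^ pred 5) by (simpl; ring).
        apply derivable_pt_lim_pow. }
      rewrite E1, E2 in Hc; exact Hc. }
  assert (h5 : r ^ 5 <> 0) by now apply pow_nonzero.
  assert (fin : forall c, c <> 0 ->
            r ^ 5 * (c ^ 4 * G c) = P r * (5 * c ^ 4) -> P r / r ^ 5 = G c / 5).
  { intros c hc e.
    assert (h4 : c ^ 4 <> 0) by now apply pow_nonzero.
    apply (Rmult_eq_reg_r (5 * (c ^ 4 * r ^ 5))).
    - field_simplify; [lra | auto].
    - repeat apply Rmult_integral_contrapositive_currified; auto; lra. }
  destruct (Rlt_le_dec 0 r) as [hp|hn].
  - destruct (key 0 r hp) as [c [hc e]]; exists c; split.
    + rewrite !Rabs_pos_eq; lra.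
    + apply fin; [lra|]. rewrite P0 in e; simpl (0 ^ 5) in e; lra.
  - destruct (key r 0 ltac:(lra)) as [c [hc e]]; exists c; split.
    + rewrite !Rabs_left; lra.
    + apply fin; [lra|]. rewrite P0 in e; simpl (0 ^ 5) in e; lra.
Qed.

Lemma avg_cpt (G : R -> R) (r : R) :
  (forall x, continuity_pt G x) -> continuity_pt (avg G) r.
Proof.
  intros hG.
  destruct (Req_dec_T r 0) as [->|hr].
  - apply cpt_eps; intros eps he.
    destruct (proj1 (cpt_eps G 0) (hG 0) eps he) as [d [hd Hd]].
    exists d; split; auto; intros y hy; rewrite Rminus_0_r in hy.
    rewrite avg_0.
    destruct (Req_dec y 0) as [->|hy0].
    + rewrite avg_0, Rminus_diag, Rabs_R0; auto.
    + destruct (avg_mean G y hG hy0) as [c [hc ->]].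
      specialize (Hd c); rewrite Rminus_0_r in Hd.
      specialize (Hd (Rle_lt_trans _ _ _ hc hy)).
      apply Rabs_lt_between in Hd; apply Rabs_lt_between; lra.
  - exact (is_derive_cpt _ _ _ (avg_derive G r hG hr)).
Qed.

(** The bound is shaped so that [s ^ 4] times its right-hand side is the
    derivative of [c s ^ 5 exp (lam s)]; the term [lam s] keeps the gain of a
    factor [1 / lam] when the data vanish like [s] at the origin. *)
Lemma avg_diff_le (G1 G2 : R -> R) (c lam r : R) :
  (forall x, continuity_pt G1 x) -> (forall x, continuity_pt G2 x) ->
  0 < r ->
  (forall s, 0 < s < r ->
     Rabs (G1 s - G2 s) <= c * ((5 + lam * s) * exp (lam * s))) ->
  Rabs (avg G1 r - avg G2 r) <= c * exp (lam * r).
Proof.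
  intros h1 h2 hr hle.
  rewrite !avg_ne by lra.
  assert (hP1 := fun x => primitive_derive _ x (moment_cpt G1 h1)).
  assert (hP2 := fun x => primitive_derive _ x (moment_cpt G2 h2)).
  assert (Z1 := primitive_0 (fun s => s ^ 4 * G1 s)).
  assert (Z2 := primitive_0 (fun s => s ^ 4 * G2 s)).
  set (P1 := primitive (fun s => s ^ 4 * G1 s)) in *.
  set (P2 := primitive (fun s => s ^ 4 * G2 s)) in *.
  assert (dN : forall x, is_derive (fun s => c * (s ^ 5 * exp (lam * s))) x
                 (c * (x ^ 4 * ((5 + lam * x) * exp (lam * x))))).
  { intros x; auto_derive; auto; ring. }
  assert (H := increment_le_of_derive (fun s => P1 s - P2 s)
     (fun s => s ^ 4 * G1 s - s ^ 4 * G2 s)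
     (fun s => c * (s ^ 5 * exp (lam * s)))
     (fun x => c * (x ^ 4 * ((5 + lam * x) * exp (lam * x)))) 0 r).
  assert (h5 : 0 < r ^ 5) by (apply pow_lt; lra).
  replace (P1 r / r ^ 5 - P2 r / r ^ 5)
    with ((P1 r - P2 r - (P1 0 - P2 0)) / r ^ 5)
    by (rewrite Z1, Z2; field; lra).
  unfold Rdiv; rewrite Rabs_mult, (Rabs_pos_eq (/ r ^ 5))
    by (left; now apply Rinv_0_lt_compat).
  apply (Rmult_le_reg_r (r ^ 5)); auto.
  rewrite Rmult_assoc, Rinv_l, Rmult_1_r by lra.
  apply Rle_trans with
    (c * (r ^ 5 * exp (lam * r)) - c * (0 ^ 5 * exp (lam * 0))); [|lra].
  apply H; try lra.
  - intros x _; apply cpt_minus; eapply is_derive_cpt; [apply hP1|apply hP2].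
  - intros x _; eapply is_derive_cpt; apply dN.
  - intros x _; apply (is_derive_minus P1 P2); [apply hP1 | apply hP2].
  - intros x _; apply dN.
  - intros x hx; specialize (hle x hx).
    assert (h4 : 0 < x ^ 4) by (apply pow_lt; lra).
    rewrite <- Rmult_minus_distr_l, Rabs_mult, (Rabs_pos_eq (x ^ 4)) by lra.
    apply Rle_trans with
      (x ^ 4 * (c * ((5 + lam * x) * exp (lam * x)))); [|lra].
    apply Rmult_le_compat_l; lra.
Qed.

Lemma exp_nondecreasing (x y : R) : x <= y -> exp x <= exp y.
Proof. intros [h | ->]; [left; now apply exp_increasing | lra]. Qed.

Lemma geometric_cauchy (a : nat -> R) (C : R) :
  (forall n, Rabs (a (S n) - a n) <= C / 2 ^ n) ->
  forall n, Rabs (a n - real (Lim_seq a)) <= 2 * C / 2 ^ n.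
Proof.
  intros h.
  assert (pw : forall n, 0 < / 2 ^ n)
    by (intros n; apply Rinv_0_lt_compat, pow_lt; lra).
  assert (C0 : 0 <= C).
  { generalize (h 0%nat) (Rabs_pos (a 1%nat - a 0%nat)); simpl; lra. }
  assert (tail : forall n k,
             Rabs (a n - a (n + k)%nat) <= 2 * C / 2 ^ n - 2 * C / 2 ^ (n + k)).
  { intros n k; induction k as [|k IH].
    - rewrite Nat.add_0_r, !Rminus_diag, Rabs_R0; lra.
    - rewrite Nat.add_succ_r.
      replace (a n - a (S (n + k)))
        with ((a n - a (n + k)%nat) + - (a (S (n + k)) - a (n + k)%nat)) by ring.
      generalize (h (n + k)%nat) (Rabs_triang (a n - a (n + k)%nat)
        (- (a (S (n + k)) - a (n + k)%nat))).
      rewrite Rabs_Ropp.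
      replace (2 * C / 2 ^ S (n + k)) with (C / 2 ^ (n + k))
        by (simpl; field; apply pow_nonzero; lra).
      lra. }
  assert (tail' : forall n k, Rabs (a n - a (n + k)%nat) <= 2 * C / 2 ^ n).
  { intros n k; generalize (tail n k) (pw (n + k)%nat); intros.
    assert (0 <= 2 * C / 2 ^ (n + k)) by (apply Rmult_le_pos; lra); lra. }
  assert (cv : ex_finite_lim_seq a).
  { apply ex_lim_seq_cauchy_corr; intros eps.
    destruct (pow_lt_1_zero (/ 2)) with (y := eps / (4 * C + 1)) as [N HN].
    { rewrite Rabs_pos_eq; lra. }
    { apply Rdiv_lt_0_compat; [apply cond_pos | lra]. }
    exists N; intros n m hn hm.
    specialize (HN N (Nat.le_refl N)).
    rewrite pow_inv, Rabs_pos_eq in HN by (left; apply pw).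
    apply Rmult_lt_compat_r with (r := 4 * C + 1) in HN; [|lra].
    unfold Rdiv in HN; rewrite Rmult_assoc, Rinv_l, Rmult_1_r in HN by lra.
    replace n with (N + (n - N))%nat by lia.
    replace m with (N + (m - N))%nat by lia.
    generalize (tail' N (n - N)%nat) (tail' N (m - N)%nat) (pw N).
    unfold Rdiv; intros t1 t2 t3.
    apply Rabs_le_between in t1; apply Rabs_le_between in t2.
    apply Rabs_lt_between; lra. }
  intros n.
  assert (L := Lim_seq_correct' a cv).
  apply (is_lim_seq_incr_n a n) in L.
  assert (L' : is_lim_seq (fun k => Rabs (a n - a (k + n)%nat))
                          (Rabs (a n - real (Lim_seq a)))).
  { apply (is_lim_seq_abs _ (a n - real (Lim_seq a))).
    apply is_lim_seq_minus'; [apply is_lim_seq_const | exact L]. }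
  apply (is_lim_seq_le (fun k => Rabs (a n - a (k + n)%nat))
           (fun _ => 2 * C / 2 ^ n) (Rabs (a n - real (Lim_seq a)))
           (2 * C / 2 ^ n)); auto.
  - intros k; rewrite Nat.add_comm; apply tail'.
  - apply is_lim_seq_const.
Qed.

Definition step (F : R -> R -> R -> R) (alpha : R) (p : R -> R) : R -> R :=
  avg (fun s => F s (alpha + primitive p s) (p s)).

Fixpoint picard (F : R -> R -> R -> R) (alpha : R) (n : nat) : R -> R :=
  match n with
  | O => fun _ => 0
  | S m => step F alpha (picard F alpha m)
  end.

Definition preserves_continuity (F : R -> R -> R -> R) : Prop :=
  forall z p : R -> R,
    (forall x, continuity_pt z x) -> (forall x, continuity_pt p x) ->
    forall x, continuity_pt (fun r => F r (z r) (p r)) x.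

(** The Lipschitz constant in the last variable vanishes at the origin like
    [r]; without this factor, averaging would gain nothing and the singular
    equation could have several bounded solutions. *)
Definition singular_lipschitz (F : R -> R -> R -> R) (b L : R) : Prop :=
  forall r z p z' p', 0 <= r <= b ->
    Rabs (F r z p - F r z' p') <= L * (Rabs (z - z') + r * Rabs (p - p')).

Lemma primitive_cpt (f : R -> R) (x : R) :
  (forall y, continuity_pt f y) -> continuity_pt (primitive f) x.
Proof. intros h; exact (is_derive_cpt _ _ _ (primitive_derive f x h)). Qed.

Lemma rhs_cpt (F : R -> R -> R -> R) (alpha : R) (p : R -> R) :
  preserves_continuity F -> (forall x, continuity_pt p x) ->
  forall x, continuity_pt (fun s => F s (alpha + primitive p s) (p s)) x.
Proof.
  intros hF hp; apply (hF (fun s => alpha + primitive p s) p); auto.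
  intros x; cpt; now apply primitive_cpt.
Qed.

Lemma picard_cpt (F : R -> R -> R -> R) (alpha : R) (n : nat) :
  preserves_continuity F -> forall x, continuity_pt (picard F alpha n) x.
Proof.
  intros hF; induction n as [|n IH]; intros x; simpl.
  - apply cpt_const.
  - now apply avg_cpt, rhs_cpt.
Qed.

(** In the norm weighted by [exp (lam r)], both the integration giving [z] and
    the average giving [p] gain a factor [1 / lam]. *)
Lemma step_contracts (F : R -> R -> R -> R) (alpha b L lam B : R)
  (p q : R -> R) :
  preserves_continuity F -> singular_lipschitz F b L ->
  0 <= L -> 0 < lam -> 0 <= B ->
  (forall x, continuity_pt p x) -> (forall x, continuity_pt q x) ->
  (forall s, 0 <= s <= b -> Rabs (p s - q s) <= B * exp (lam * s)) ->
  forall r, 0 <= r <= b ->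
    Rabs (step F alpha p r - step F alpha q r)
    <= L * B / lam * exp (lam * r).
Proof.
  intros hF hL L0 lam0 B0 hp hq hpq r hr.
  assert (c0 : 0 <= L * B / lam)
    by (apply Rdiv_le_0_compat; [now apply Rmult_le_pos | lra]).
  assert (hz : forall s, 0 <= s <= b ->
     Rabs (primitive p s - primitive q s) <= B / lam * exp (lam * s)).
  { intros s hs.
    assert (H := increment_le_of_derive (fun x => primitive p x - primitive q x)
      (fun x => p x - q x) (fun x => B / lam * exp (lam * x))
      (fun x => B * exp (lam * x)) 0 s).
    cbv beta in H; rewrite !primitive_0, Rminus_0_r, Rminus_0_r in H.
    assert (0 <= B / lam) by (apply Rdiv_le_0_compat; lra).
    apply Rle_trans with
      (B / lam * exp (lam * s) - B / lam * exp (lam * 0));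
      [|generalize (exp_pos (lam * 0)); nra].
    assert (dg : forall x, is_derive (fun x => B / lam * exp (lam * x)) x
                             (B * exp (lam * x))).
    { intros x; auto_derive; auto; field; lra. }
    apply H; try lra.
    - intros x _; cpt; now apply primitive_cpt.
    - intros x _; exact (is_derive_cpt _ _ _ (dg x)).
    - intros x _; apply (is_derive_minus (primitive p) (primitive q));
        now apply primitive_derive.
    - intros x _; apply dg.
    - intros x hx; apply hpq; lra. }
  unfold step; destruct (Req_dec r 0) as [->|hr0].
  - rewrite !avg_0, !primitive_0.
    assert (h := hL 0 (alpha + 0) (p 0) (alpha + 0) (q 0) ltac:(lra)).
    rewrite Rminus_diag, Rabs_R0, Rmult_0_l, Rplus_0_l, Rmult_0_r in h.
    apply Rabs_le_between in h.
    assert (0 <= L * B / lam * exp (lam * 0))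
      by (apply Rmult_le_pos; [auto | left; apply exp_pos]).
    apply Rabs_le; lra.
  - apply avg_diff_le; try (now apply rhs_cpt); [lra|].
    intros s hs.
    specialize (hz s ltac:(lra)); specialize (hpq s ltac:(lra)).
    eapply Rle_trans; [apply hL; lra|].
    replace (alpha + primitive p s - (alpha + primitive q s))
      with (primitive p s - primitive q s) by ring.
    assert (he := exp_pos (lam * s)).
    apply Rle_trans with
      (L * (B / lam * exp (lam * s) + s * (B * exp (lam * s)))).
    + apply Rmult_le_compat_l; auto; apply Rplus_le_compat; auto.
      apply Rmult_le_compat_l; lra.
    + replace (L * (B / lam * exp (lam * s) + s * (B * exp (lam * s))))
        with (L * B / lam * ((1 + lam * s) * exp (lam * s))) by (field; lra).
      apply Rmult_le_compat_l; auto; apply Rmult_le_compat_r; lra.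
Qed.

(** The iterates converge geometrically in that norm on every [0 <= r <= b], with
    [lam] depending on [b]; since they do not depend on [b], their limit is a
    solution on the whole half-line. *)
Theorem singular_ode_solvable (F : R -> R -> R -> R) (alpha : R) :
  preserves_continuity F ->
  (forall b, 0 <= b -> exists L, 0 <= L /\ singular_lipschitz F b L) ->
  exists z p : R -> R,
    z 0 = alpha /\
    (forall x, continuity_pt p x) /\
    (forall r, is_derive z r (p r)) /\
    (forall r, 0 < r -> is_derive p r ((F r (z r) (p r) - 5 * p r) / r)) /\
    5 * p 0 = F 0 (z 0) (p 0).
Proof.
  intros hF hLip.
  set (P := picard F alpha).
  assert (Pc : forall n x, continuity_pt (P n) x)
    by (intros n x; now apply picard_cpt).
  set (p := fun r => real (Lim_seq (fun n => P n (Rmax 0 r)))).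
  assert (rate : forall b, 0 <= b -> exists L lam B,
    0 <= L /\ singular_lipschitz F b L /\ 0 < lam /\ 2 * L <= lam /\ 0 <= B /\
    forall n r, 0 <= r <= b ->
      Rabs (P n r - p r) <= B / 2 ^ n * exp (lam * r)).
  { intros b hb; destruct (hLip b hb) as [L [L0 HL]].
    destruct (cpt_bounded (fun x => P 1%nat x - P 0%nat x) 0 b) as [B [B0 HB]].
    { intros x _; apply cpt_minus; apply Pc. }
    (* This weight makes the contraction factor [L / lam] less than 1/2. *)
    exists L, (2 * L + 1), (2 * B).
    repeat (split; [lra || assumption|]).
    intros n r hr.
    assert (pow2 : forall n, 0 < / 2 ^ n)
      by (intros m; apply Rinv_0_lt_compat, pow_lt; lra).
    assert (incr : forall n s, 0 <= s <= b ->
      Rabs (P (S n) s - P n s) <= B / 2 ^ n * exp ((2 * L + 1) * s)).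
    { clear n r hr; induction n as [|n IH]; intros s hs.
      - apply Rle_trans with B; [now apply HB|].
        replace (B / 2 ^ 0) with B by (simpl; field).
        assert (1 <= exp ((2 * L + 1) * s)).
        { generalize (exp_ineq1_le ((2 * L + 1) * s)).
          assert (0 <= (2 * L + 1) * s) by (apply Rmult_le_pos; lra); lra. }
        nra.
      - assert (Bn : 0 <= B / 2 ^ n)
          by (apply Rmult_le_pos; [lra | left; apply pow2]).
        eapply Rle_trans;
          [apply (step_contracts F alpha b L (2 * L + 1) (B / 2 ^ n)
                    (P (S n)) (P n)); auto; lra|].
        apply Rmult_le_compat_r; [left; apply exp_pos|].
        replace (B / 2 ^ S n) with (B / 2 ^ n / 2)
          by (simpl; field; apply pow_nonzero; lra).
        apply (Rmult_le_reg_r (2 * L + 1)); [lra|].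
        unfold Rdiv at 1; rewrite Rmult_assoc, Rinv_l, Rmult_1_r by lra.
        nra. }
    assert (G := geometric_cauchy (fun k => P k r)
                   (B * exp ((2 * L + 1) * r))).
    unfold p; rewrite Rmax_right by lra.
    replace (2 * B / 2 ^ n * exp ((2 * L + 1) * r))
      with (2 * (B * exp ((2 * L + 1) * r)) / 2 ^ n)
      by (field; apply pow_nonzero; lra).
    apply G; intros k.
    replace (B * exp ((2 * L + 1) * r) / 2 ^ k)
      with (B / 2 ^ k * exp ((2 * L + 1) * r))
      by (field; apply pow_nonzero; lra).
    now apply incr. }
  assert (small : forall c eps, 0 <= c -> 0 < eps -> exists n, c / 2 ^ n < eps).
  { intros c eps hc he.
    destruct (pow_lt_1_zero (/ 2)) with (y := eps / (c + 1)) as [N HN].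
    { rewrite Rabs_pos_eq; lra. }
    { apply Rdiv_lt_0_compat; lra. }
    exists N; specialize (HN N (Nat.le_refl N)).
    assert (pw : 0 < / 2 ^ N) by (apply Rinv_0_lt_compat, pow_lt; lra).
    rewrite pow_inv, Rabs_pos_eq in HN by lra.
    apply Rmult_lt_compat_r with (r := c + 1) in HN; [|lra].
    unfold Rdiv in *; rewrite Rmult_assoc, Rinv_l, Rmult_1_r in HN by lra.
    lra. }
  assert (pmax : forall r, p r = p (Rmax 0 r)).
  { intros r; unfold p; rewrite (Rmax_right 0 (Rmax 0 r)); auto; apply Rmax_l. }
  assert (pc : forall x, continuity_pt p x).
  { intros x; apply cpt_eps; intros eps he.
    assert (hb : 0 <= Rmax 0 x + 1) by (generalize (Rmax_l 0 x); lra).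
    destruct (rate _ hb) as [L [lam [B [_ [_ [lam0 [_ [B0 H]]]]]]]].
    set (e := exp (lam * (Rmax 0 x + 1))) in *.
    assert (e0 : 0 < e) by apply exp_pos.
    destruct (small (B * e) (eps / 3)) as [n Hn]; [nra|lra|].
    assert (close : forall y, 0 <= y <= Rmax 0 x + 1 ->
              Rabs (P n y - p y) < eps / 3).
    { intros y hy; apply Rle_lt_trans with (1 := H n y hy).
      apply Rle_lt_trans with (2 := Hn).
      replace (B * e / 2 ^ n) with (B / 2 ^ n * e)
        by (field; apply pow_nonzero; lra).
      apply Rmult_le_compat_l.
      - apply Rmult_le_pos; auto; left; apply Rinv_0_lt_compat, pow_lt; lra.
      - apply exp_nondecreasing, Rmult_le_compat_l; lra. }
    destruct (proj1 (cpt_eps (P n) (Rmax 0 x)) (Pc n _) (eps / 3) ltac:(lra))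
      as [d [hd Hd]].
    exists (Rmin 1 d); split; [apply Rmin_glb_lt; lra|]; intros y hy.
    assert (hm := Rmax_near x y).
    assert (hy1 := Rlt_le_trans _ _ _ hy (Rmin_l 1 d)).
    assert (hy2 := Rlt_le_trans _ _ _ hy (Rmin_r 1 d)).
    specialize (Hd (Rmax 0 y) (Rle_lt_trans _ _ _ hm hy2)).
    assert (hm1 := Rle_lt_trans _ _ _ hm hy1).
    apply Rabs_lt_between in hm1.
    assert (c1 := close (Rmax 0 y)
                    ltac:(generalize (Rmax_l 0 y); lra)).
    assert (c2 := close (Rmax 0 x)
                    ltac:(generalize (Rmax_l 0 x); lra)).
    rewrite (pmax x), (pmax y).
    apply Rabs_lt_between in Hd; apply Rabs_lt_between in c1;
      apply Rabs_lt_between in c2; apply Rabs_lt_between; lra. }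
  assert (fixed : forall r, 0 <= r -> p r = step F alpha p r).
  { intros r hr.
    destruct (rate r hr) as [L [lam [B [L0 [HL [lam0 [hlam [B0 H]]]]]]]].
    destruct (Req_dec (p r) (step F alpha p r)) as [|hne]; auto; exfalso.
    assert (hpos : 0 < Rabs (p r - step F alpha p r))
      by (apply Rabs_pos_lt; lra).
    set (e := exp (lam * r)) in *.
    assert (e0 : 0 < e) by apply exp_pos.
    destruct (small (B * e) (Rabs (p r - step F alpha p r))) as [n Hn];
      [nra | lra |].
    assert (pw : 0 < / 2 ^ n) by (apply Rinv_0_lt_compat, pow_lt; lra).
    assert (Bn : 0 <= B / 2 ^ n) by (apply Rmult_le_pos; lra).
    assert (s1 := H (S n) r ltac:(lra)).
    assert (s2 := step_contracts F alpha r L lam (B / 2 ^ n) (P n) p hF HL L0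
                    lam0 Bn (Pc n) pc (H n) r ltac:(lra)).
    change (step F alpha (P n)) with (P (S n)) in s2; fold e in s1, s2.
    replace (B / 2 ^ S n) with (B / 2 ^ n / 2) in s1
      by (simpl; field; apply pow_nonzero; lra).
    assert (half : L * (B / 2 ^ n) / lam <= B / 2 ^ n / 2).
    { apply (Rmult_le_reg_r lam); [lra|].
      unfold Rdiv at 1; rewrite Rmult_assoc, Rinv_l, Rmult_1_r by lra.
      nra. }
    assert (L * (B / 2 ^ n) / lam * e <= B / 2 ^ n / 2 * e)
      by (apply Rmult_le_compat_r; lra).
    replace (B * e / 2 ^ n) with (B / 2 ^ n / 2 * e + B / 2 ^ n / 2 * e) in Hn
      by (field; apply pow_nonzero; lra).
    apply Rabs_le_between in s1; apply Rabs_le_between in s2.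
    apply (Rlt_not_le _ _ Hn), Rabs_le; lra. }
  exists (fun r => alpha + primitive p r), p.
  split; [|split; [|split; [|split]]].
  - rewrite primitive_0; lra.
  - exact pc.
  - intros r.
    replace (p r) with (0 + p r) by ring.
    apply (is_derive_plus (fun _ => alpha) (primitive p)).
    + auto_derive; auto.
    + now apply primitive_derive.
  - intros r hr; rewrite (fixed r) at 2 by lra.
    apply (is_derive_ext_loc (step F alpha p)).
    + generalize (locally_above 0 r hr); apply filter_imp.
      intros s hs; symmetry; apply fixed; lra.
    + apply (avg_derive (fun s => F s (alpha + primitive p s) (p s))).
      * now apply rhs_cpt.
      * lra.
  - rewrite (fixed 0) at 1 by lra.
    unfold step; rewrite avg_0; field.
Qed.

(** * Invariant region of the reduced equation *)

(** With [u = r z] and [p = z'] the equation becomes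
    [r p' + 5 p = reduced_rhs (h r) r z p]. *)
Definition reduced_rhs (k r z p : R) : R :=
  2 * r ^ 3 * z ^ 3 + 6 * r * z ^ 2 + k * (2 * z + r * p).

Lemma reduced_rhs_lipschitz (k r b m K z p z' p' : R) :
  0 <= r <= b -> Rabs k <= K -> Rabs z <= m -> Rabs z' <= m ->
  Rabs (reduced_rhs k r z p - reduced_rhs k r z' p')
  <= (6 * b ^ 3 * m ^ 2 + 12 * b * m + 2 * K)
     * (Rabs (z - z') + r * Rabs (p - p')).
Proof.
  intros hr hk hz hz'; unfold reduced_rhs.
  assert (r3 : 0 <= r ^ 3 <= b ^ 3)
    by (split; [apply pow_le | apply pow_incr]; lra).
  replace (2 * r ^ 3 * z ^ 3 + 6 * r * z ^ 2 + k * (2 * z + r * p)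
           - (2 * r ^ 3 * z' ^ 3 + 6 * r * z' ^ 2 + k * (2 * z' + r * p')))
    with ((2 * r ^ 3 * (z ^ 2 + z * z' + z' ^ 2) + 6 * r * (z + z')) * (z - z')
          + k * (2 * (z - z') + r * (p - p'))) by ring.
  set (A := 2 * r ^ 3 * (z ^ 2 + z * z' + z' ^ 2) + 6 * r * (z + z')).
  set (Q := 6 * b ^ 3 * m ^ 2 + 12 * b * m).
  assert (hA : Rabs A <= Q).
  { apply Rabs_le_between in hz; apply Rabs_le_between in hz'.
    assert (q1 : 0 <= z ^ 2 + z * z' + z' ^ 2 <= 3 * m ^ 2) by (split; nra).
    assert (q2 : 0 <= r ^ 3 * (z ^ 2 + z * z' + z' ^ 2) <= b ^ 3 * (3 * m ^ 2)).
    { split; [apply Rmult_le_pos; lra | apply Rmult_le_compat; lra]. }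
    assert (q3 : Rabs (r * (z + z')) <= b * (2 * m)).
    { rewrite Rabs_mult, (Rabs_pos_eq r) by lra.
      apply Rmult_le_compat; try lra; [apply Rabs_pos | apply Rabs_le; lra]. }
    apply Rabs_le_between in q3; apply Rabs_le; unfold A, Q; lra. }
  eapply Rle_trans; [apply Rabs_triang|].
  rewrite !Rabs_mult.
  assert (t1 : Rabs A * Rabs (z - z') <= Q * Rabs (z - z')).
  { apply Rmult_le_compat_r; auto; apply Rabs_pos. }
  assert (t2 : Rabs (2 * (z - z') + r * (p - p'))
               <= 2 * Rabs (z - z') + r * Rabs (p - p')).
  { eapply Rle_trans; [apply Rabs_triang|].
    rewrite !Rabs_mult, (Rabs_pos_eq 2), (Rabs_pos_eq r) by lra; lra. }
  assert (t3 : Rabs k * Rabs (2 * (z - z') + r * (p - p'))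
               <= K * (2 * Rabs (z - z') + r * Rabs (p - p'))).
  { apply Rmult_le_compat; auto; apply Rabs_pos. }
  assert (t4 : 0 <= r * Rabs (p - p'))
    by (apply Rmult_le_pos; [lra | apply Rabs_pos]).
  assert (0 <= Q) by (apply Rle_trans with (2 := hA), Rabs_pos).
  assert (0 <= K) by (apply Rle_trans with (2 := hk), Rabs_pos).
  assert (0 <= Q * (r * Rabs (p - p'))) by now apply Rmult_le_pos.
  assert (0 <= K * (r * Rabs (p - p'))) by now apply Rmult_le_pos.
  lra.
Qed.

Definition reduced_at (k z p : R -> R) (r : R) : Prop :=
  is_derive z r (p r) /\
  is_derive p r ((reduced_rhs (k r) r (z r) (p r) - 5 * p r) / r).

Definition energy (z p : R -> R) (r : R) : R :=
  r ^ 4 * ((2 * z r + r * p r) ^ 2 - (2 * z r + r ^ 2 * z r ^ 2) ^ 2).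

Lemma energy_derive (k z p : R -> R) (r : R) :
  r <> 0 -> reduced_at k z p r ->
  is_derive (energy z p) r (2 * k r * (r ^ 2 * (2 * z r + r * p r)) ^ 2).
Proof.
  intros hr [dz dp]; unfold energy, reduced_rhs in *.
  auto_derive.
  - repeat split; eexists; eassumption.
  - replace (Derive (fun y : R => z y) r) with (p r)
      by (symmetry; exact (is_derive_unique z r _ dz)).
    replace (Derive (fun y : R => p y) r) with
      ((2 * r ^ 3 * z r ^ 3 + 6 * r * z r ^ 2 + k r * (2 * z r + r * p r)
        - 5 * p r) / r)
      by (symmetry; exact (is_derive_unique p r _ dp)).
    field; auto.
Qed.

(** With [v = r ^ 2 z = r u] and [t = ln r], the energy is
    [v_t ^ 2 - (v (v + 2)) ^ 2]; it starts at 0 and the friction [h <= 0] makes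
    it decrease. *)
Lemma slope_bound (k z p : R -> R) (b : R) :
  (forall r, continuity_pt z r) -> (forall r, continuity_pt p r) ->
  (forall r, 0 < r < b -> reduced_at k z p r /\ k r <= 0) ->
  forall r, 0 < r <= b ->
    Rabs (2 * z r + r * p r) <= Rabs (z r) * Rabs (2 + r ^ 2 * z r).
Proof.
  intros cz cp eq r hr.
  assert (E0 : energy z p 0 = 0) by (unfold energy; ring).
  assert (Er : energy z p r <= energy z p 0).
  { apply (nonincreasing_of_derive (energy z p)
      (fun s => 2 * k s * (s ^ 2 * (2 * z s + s * p s)) ^ 2)); [lra|..].
    - intros s _; unfold energy; cpt; auto.
    - intros s hs; apply energy_derive; [lra|]; apply eq; lra.
    - intros s hs; destruct (eq s ltac:(lra)) as [_ hk].
      generalize (pow2_ge_0 (s ^ 2 * (2 * z s + s * p s))); nra. }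
  rewrite E0 in Er; unfold energy in Er.
  assert (h4 : 0 < r ^ 4) by (apply pow_lt; lra).
  rewrite <- Rabs_mult.
  replace (z r * (2 + r ^ 2 * z r)) with (2 * z r + r ^ 2 * z r ^ 2) by ring.
  apply Rsqr_le_abs_0; unfold Rsqr; nra.
Qed.

(** By [slope_bound] both [v = r ^ 2 z] and [v + 2] satisfy [|g'| <= C |g|], so
    neither can reach 0; between the two barriers [slope_bound] reads
    [p >= r z ^ 2], hence [z] increases. *)
Lemma invariant_region (k z p : R -> R) (b : R) :
  (forall r, continuity_pt z r) -> (forall r, continuity_pt p r) ->
  (forall r, is_derive z r (p r)) ->
  (forall r, 0 < r < b -> reduced_at k z p r /\ k r <= 0) ->
  z 0 < 0 ->
  forall r, 0 < r <= b -> z 0 <= z r < 0 /\ - 2 < r ^ 2 * z r.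
Proof.
  intros cz cp dz eq z0.
  assert (sb := slope_bound k z p b cz cp eq).
  assert (dv : forall r, is_derive (fun s => s ^ 2 * z s) r
                           (r * (2 * z r + r * p r))).
  { intros r; auto_derive; [now eexists; apply dz|].
    replace (Derive (fun y : R => z y) r) with (p r)
      by (symmetry; exact (is_derive_unique z r _ (dz r))).
    ring. }
  assert (neg : forall r, 0 <= r <= b -> z r < 0).
  { intros r hr; destruct (Rlt_le_dec (z r) 0) as [|hn]; auto; exfalso.
    destruct (first_zero (fun s => - z s) r) as [c [hc [zc pos]]]; try lra.
    { intros x _; apply (continuity_pt_opp z); auto. }
    destruct (cpt_bounded (fun s => 2 + s ^ 2 * z s) 0 b) as [M [M0 HM]].
    { intros x _; cpt; auto. }
    (* [|v'| <= |v| |2 + v| / x], and [1 / x <= 2 / c] for [c / 2 <= x]. *)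
    assert (h : (c / 2) ^ 2 * z (c / 2) = 0).
    { apply (vanishes_before (fun s => s ^ 2 * z s)
        (fun s => s * (2 * z s + s * p s)) (2 * M / c) (c / 2) c).
      - lra.
      - intros x _; apply dv.
      - intros x hx; rewrite !Rabs_mult, (Rabs_pos_eq x) by lra.
        rewrite (Rabs_pos_eq (x ^ 2)) by apply pow2_ge_0.
        apply Rle_trans with (x * (Rabs (z x) * M)).
        + apply Rmult_le_compat_l; [lra|].
          eapply Rle_trans; [apply sb; lra|].
          apply Rmult_le_compat_l; [apply Rabs_pos|]; apply HM; lra.
        + replace (2 * M / c * (x ^ 2 * Rabs (z x)))
            with (x * (Rabs (z x) * M) * (2 * x / c)) by (field; lra).
          assert (1 <= 2 * x / c).
          { apply (Rmult_le_reg_r c); [lra|].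
            unfold Rdiv; rewrite Rmult_assoc, Rinv_l; lra. }
          assert (0 <= x * (Rabs (z x) * M)).
          { apply Rmult_le_pos; [lra|].
            apply Rmult_le_pos; [apply Rabs_pos | lra]. }
          nra.
      - replace (z c) with 0 by lra; ring. }
    specialize (pos (c / 2) ltac:(lra)).
    assert (0 < (c / 2) ^ 2) by (apply pow_lt; lra).
    nra. }
  assert (low : forall r, 0 <= r <= b -> 0 < 2 + r ^ 2 * z r).
  { intros r hr; destruct (Rlt_le_dec 0 (2 + r ^ 2 * z r)) as [|hn]; auto.
    exfalso.
    destruct (first_zero (fun s => 2 + s ^ 2 * z s) r)
      as [c [hc [zc pos]]]; try lra.
    { intros x _; cpt; auto. }
    destruct (cpt_bounded z 0 b) as [M [M0 HM]]; auto.
    assert (h : 2 + (c / 2) ^ 2 * z (c / 2) = 0).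
    { apply (vanishes_before (fun s => 2 + s ^ 2 * z s)
        (fun s => s * (2 * z s + s * p s)) (b * M) (c / 2) c).
      - lra.
      - intros x _.
        replace (x * (2 * z x + x * p x))
          with (0 + x * (2 * z x + x * p x)) by ring.
        apply (is_derive_plus (fun _ => 2)); [auto_derive; auto | apply dv].
      - intros x hx; rewrite Rabs_mult, (Rabs_pos_eq x), Rmult_assoc by lra.
        apply Rmult_le_compat; [lra | apply Rabs_pos | lra |].
        eapply Rle_trans; [apply sb; lra|].
        apply Rmult_le_compat_r; [apply Rabs_pos|]; apply HM; lra.
      - exact zc. }
    specialize (pos (c / 2) ltac:(lra)); simpl in *; lra. }
  intros r hr.
  assert (n := neg r ltac:(lra)); assert (l := low r ltac:(lra)).
  repeat split; try lra.
  assert (- z r <= - z 0); [|lra].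
  apply (nonincreasing_of_derive (fun s => - z s) (fun s => - p s)); [lra|..].
  - intros x _; apply (continuity_pt_opp z); auto.
  - intros x _; apply (is_derive_opp z); auto.
  - intros x hx; specialize (sb x ltac:(lra)).
    assert (nx := neg x ltac:(lra)); assert (lx := low x ltac:(lra)).
    rewrite (Rabs_left (z x)), (Rabs_pos_eq (2 + _)) in sb by lra.
    apply Rabs_le_between in sb.
    assert (0 <= x * (p x - x * z x ^ 2)) by lra.
    assert (0 <= x * z x ^ 2)
      by (apply Rmult_le_pos; [lra | apply pow2_ge_0]).
    nra.
Qed.

(** * Global existence *)

Definition clamp (m z : R) : R := Rmax m (Rmin 0 z).

Lemma clamp_id (m z : R) : m <= z <= 0 -> clamp m z = z.
Proof. intros hz; unfold clamp; rewrite Rmin_right, Rmax_right; lra. Qed.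

Lemma clamp_range (m z : R) : m <= 0 -> m <= clamp m z <= 0.
Proof.
  intros hm; unfold clamp; split; [apply Rmax_l|].
  apply Rmax_lub; [auto | apply Rmin_l].
Qed.

Lemma clamp_lipschitz (m z w : R) :
  Rabs (clamp m z - clamp m w) <= Rabs (z - w).
Proof.
  unfold clamp, Rmax, Rmin, Rabs.
  repeat destruct Rle_dec; repeat destruct Rcase_abs; lra.
Qed.

Definition truncated_rhs (k : R -> R) (m r z p : R) : R :=
  reduced_rhs (k r) r (clamp m z) p.

Lemma truncated_continuous (k : R -> R) (m : R) :
  (forall x, continuity_pt k x) ->
  preserves_continuity (truncated_rhs k m).
Proof.
  intros ck z p cz cp x; unfold truncated_rhs, reduced_rhs.
  assert (cc : continuity_pt (fun r => clamp m (z r)) x).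
  { apply cpt_eps; intros eps he.
    destruct (proj1 (cpt_eps z x) (cz x) eps he) as [d [hd Hd]].
    exists d; split; auto; intros y hy.
    eapply Rle_lt_trans; [apply clamp_lipschitz | auto]. }
  cpt; auto.
Qed.

Lemma truncated_lipschitz (k : R -> R) (m b : R) :
  (forall x, continuity_pt k x) -> m <= 0 -> 0 <= b ->
  exists L, 0 <= L /\ singular_lipschitz (truncated_rhs k m) b L.
Proof.
  intros ck hm hb.
  destruct (cpt_bounded k 0 b) as [K [K0 HK]]; auto.
  exists (6 * b ^ 3 * (- m) ^ 2 + 12 * b * - m + 2 * K).
  assert (L0 : 0 <= 6 * b ^ 3 * (- m) ^ 2 + 12 * b * - m + 2 * K).
  { assert (0 <= b ^ 3 * (- m) ^ 2)
      by (apply Rmult_le_pos; [now apply pow_le | apply pow2_ge_0]).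
    assert (0 <= b * - m) by (apply Rmult_le_pos; lra). lra. }
  split; [exact L0|].
  intros r z p z' p' hr; unfold truncated_rhs.
  eapply Rle_trans.
  - apply (reduced_rhs_lipschitz (k r) r b (- m) K); auto;
      apply Rabs_le; generalize (clamp_range m z hm) (clamp_range m z' hm); lra.
  - apply Rmult_le_compat_l, Rplus_le_compat_r, clamp_lipschitz; exact L0.
Qed.

(** The solution of the equation truncated below at [2 alpha] and above at 0
    never leaves the interval between these values: up to the time when it
    would, [invariant_region] confines it to [alpha <= z < 0]. The lower level is
    placed strictly below the initial value [alpha], so that the exit time is
    positive. *)
Lemma reduced_global (k : R -> R) (alpha : R) :
  (forall x, continuity_pt k x) -> (forall r, 0 < r -> k r <= 0) ->
  alpha < 0 ->
  exists z p : R -> R,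
    z 0 = alpha /\
    (forall r, continuity_pt p r) /\
    (forall r, is_derive z r (p r)) /\
    (forall r, 0 < r -> reduced_at k z p r) /\
    5 * p 0 = reduced_rhs (k 0) 0 (z 0) (p 0) /\
    (forall r, 0 < r -> z r < 0 /\ - 2 < r ^ 2 * z r).
Proof.
  intros ck kneg ha.
  destruct (singular_ode_solvable (truncated_rhs k (2 * alpha)) alpha)
    as [z [p [z0 [cp [dz [dp p0]]]]]].
  { now apply truncated_continuous. }
  { intros b hb; apply truncated_lipschitz; auto; lra. }
  assert (cz : forall r, continuity_pt z r)
    by (intros r; exact (is_derive_cpt _ _ _ (dz r))).
  assert (same : forall r, 2 * alpha <= z r <= 0 ->
            truncated_rhs k (2 * alpha) r (z r) (p r)
            = reduced_rhs (k r) r (z r) (p r)).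
  { intros r hr; unfold truncated_rhs; rewrite clamp_id; auto. }
  assert (inside : forall b, 0 <= b -> 2 * alpha < z b < 0).
  { assert (iff : forall x, 0 < z x * (2 * alpha - z x) -> 2 * alpha < z x < 0).
    { intros x hx; split; nra. }
    intros b hb; apply iff.
    destruct (Rlt_le_dec 0 (z b * (2 * alpha - z b))) as [|hn]; auto; exfalso.
    destruct (first_zero (fun s => z s * (2 * alpha - z s)) b)
      as [c [hc [zc pos]]]; auto.
    { intros x _; cpt; auto. }
    { rewrite z0; nra. }
    assert (H := invariant_region k z p c cz cp dz).
    destruct (H) with (r := c) as [[H1 H2] _]; try lra.
    - intros r hr; split; [|apply kneg; lra].
      split; [apply dz|]; rewrite <- same; [apply dp; lra|].
      generalize (iff r (pos r ltac:(lra))); lra.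
    - rewrite z0 in H1; nra. }
  assert (eq : forall r, 0 < r -> reduced_at k z p r).
  { intros r hr; split; [apply dz|]; rewrite <- same; [now apply dp|].
    generalize (inside r ltac:(lra)); lra. }
  exists z, p; split; [|split; [|split; [|split; [|split]]]]; auto.
  - rewrite <- same; [auto|]; generalize (inside 0 ltac:(lra)); lra.
  - intros r hr.
    destruct (invariant_region k z p r cz cp dz) with (r := r) as [[_ H] H'];
      auto; try lra.
    intros s hs; split; [apply eq | apply kneg]; lra.
Qed.

Lemma is_derive_id_mult_0 (p : R -> R) :
  continuity_pt p 0 -> is_derive (fun r => r * p r) 0 (p 0).
Proof.
  intros cp; apply is_derive_Reals; intros eps he.
  destruct (proj1 (cpt_eps p 0) cp eps he) as [d [hd Hd]].
  exists (mkposreal d hd); intros s hs0 hs; rewrite Rplus_0_l, Rmult_0_l.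
  replace ((s * p s - 0) / s) with (p s) by (field; auto).
  apply Hd; rewrite Rminus_0_r; exact hs.
Qed.

(** Although [z''] need not exist at 0, [u = r z] is of class [C^2] there:
    [u'' = 2 p + r p'] equals [F - 3 p] off the origin, which is continuous up to
    it, and the relation [5 p(0) = F(0)] makes the value [2 p(0)] match. *)
Lemma global_solution_exists (h : R -> R) (alpha : R) :
  C0_on (ico p_infty) h -> (forall r, 0 < r -> h r <= 0) -> alpha < 0 ->
  exists u, global_solution h alpha u /\
    forall r, 0 < r -> - (2 / r) < u r < 0.
Proof.
  intros hc hn ha.
  set (k := fun r => h (Rmax 0 r)).
  assert (ck : forall x, continuity_pt k x)
    by (intros x; apply (cpt_half_line p_infty); simpl; auto).
  assert (kE : forall r, 0 <= r -> k r = h r)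
    by (intros r hr; unfold k; rewrite Rmax_right; auto).
  destruct (reduced_global k alpha ck) as [z [p [z0 [cp [dz [eq [p0 bd]]]]]]];
    auto.
  { intros r hr; rewrite kE by lra; auto. }
  exists (fun r => r * z r); split; [split; [exact I|]|].
  - exists (fun r => z r + r * p r),
      (fun r => reduced_rhs (k r) r (z r) (p r) - 3 * p r).
    assert (cz : forall r, continuity_pt z r)
      by (intros r; exact (is_derive_cpt _ _ _ (dz r))).
    split; [split; [|split]|split; [|split]].
    + apply derivative_on_of_is_derive; intros r _.
      auto_derive; [now eexists; apply dz|].
      replace (Derive (fun y : R => z y) r) with (p r)
        by (symmetry; exact (is_derive_unique z r _ (dz r))).
      ring.
    + apply derivative_on_of_is_derive; intros r [hr _].
      apply Rle_lt_or_eq_dec in hr; destruct hr as [hr|<-].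
      * destruct (eq r hr) as [_ dp].
        auto_derive.
        { repeat split; eexists; [apply dz | apply dp]. }
        replace (Derive (fun y : R => z y) r) with (p r)
          by (symmetry; exact (is_derive_unique z r _ (dz r))).
        replace (Derive (fun y : R => p y) r) with
          ((reduced_rhs (k r) r (z r) (p r) - 5 * p r) / r)
          by (symmetry; exact (is_derive_unique p r _ dp)).
        field; lra.
      * rewrite <- p0.
        replace (5 * p 0 - 3 * p 0) with (p 0 + p 0) by ring.
        apply (is_derive_plus z (fun r => r * p r)); [apply dz|].
        now apply is_derive_id_mult_0.
    + apply C0_on_of_cpt; intros r _; unfold reduced_rhs; cpt; auto.
    + intros r hr _; unfold equation_at, reduced_rhs.
      rewrite kE by lra; field; lra.
    + ring.
    + rewrite z0; ring.
  - intros r hr; destruct (bd r hr) as [b1 b2]; split; [|nra].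
    apply (Rmult_lt_reg_r r); auto.
    replace (- (2 / r) * r) with (- 2) by (field; lra); lra.
Qed.

(** * Uniqueness *)

Lemma increment_on (T : Rbar) (f f' : R -> R) (M r : R) :
  Rbar_lt 0 T -> derivative_on (ico T) f f' -> f 0 = 0 ->
  0 <= r -> Rbar_lt r T ->
  (forall s, 0 < s < r -> Rabs (f' s) <= M) -> Rabs (f r) <= M * r.
Proof.
  intros hT df f0 hr hrT hM.
  assert (below : forall s : R, s <= r -> Rbar_lt s T)
    by (intros s hs; apply (Rbar_le_lt_trans s r); auto).
  assert (H := increment_le_of_derive (fun s => f (Rmax 0 s)) f'
                 (fun s => M * s) (fun _ => M) 0 r hr).
  cbv beta in H; rewrite !Rmax_right, f0, Rmult_0_r, !Rminus_0_r in H by lra.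
  apply H; auto.
  - intros x hx; apply (cpt_half_line T); auto.
    + now apply derivative_on_C0 with f'.
    + apply below; lra.
  - intros x _; cpt.
  - intros x hx; apply (is_derive_ext_loc f).
    + generalize (locally_above 0 x (proj1 hx)); apply filter_imp.
      intros s hs; rewrite Rmax_right; auto; lra.
    + apply (derivative_on_interior T); auto; [lra | apply below; lra].
  - intros x _; auto_derive; auto; ring.
Qed.

Lemma C0_on_bounded (T : Rbar) (f : R -> R) (b : R) :
  Rbar_lt 0 T -> C0_on (ico T) f -> 0 <= b -> Rbar_lt b T ->
  exists M, 0 < M /\ forall s, 0 <= s <= b -> Rabs (f s) <= M.
Proof.
  intros hT hf hb hbT.
  destruct (cpt_bounded (fun s => f (Rmax 0 s)) 0 b) as [M [M0 HM]].
  - intros x hx; apply (cpt_half_line T); auto.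
    apply (Rbar_le_lt_trans x b); simpl; auto; lra.
  - exists M; split; auto; intros s hs; specialize (HM s hs).
    rewrite Rmax_right in HM; auto; lra.
Qed.

Lemma derivative_on_minus (D : R -> Prop) (f f' g g' : R -> R) :
  derivative_on D f f' -> derivative_on D g g' ->
  derivative_on D (fun x => f x - g x) (fun x => f' x - g' x).
Proof. intros hf hg x hx; apply Dminus; auto. Qed.

Lemma solution_reduced (h u u' u'' : R -> R) (r : R) :
  r <> 0 -> is_derive u r (u' r) -> is_derive u' r (u'' r) ->
  equation_at h u u' u'' r ->
  reduced_at h (fun s => u s / s) (fun s => (u' s - u s / s) / s) r.
Proof.
  intros hr du du' eq; split.
  - auto_derive; [split; [now eexists; apply du|auto]|].
    replace (Derive (fun y : R => u y) r) with (u' r)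
      by (symmetry; exact (is_derive_unique u r _ du)).
    field; auto.
  - auto_derive; [repeat split; auto; eexists; [apply du' | apply du]|].
    replace (Derive (fun y : R => u y) r) with (u' r)
      by (symmetry; exact (is_derive_unique u r _ du)).
    replace (Derive (fun y : R => u' y) r) with (u'' r)
      by (symmetry; exact (is_derive_unique u' r _ du')).
    unfold equation_at in eq; unfold reduced_rhs.
    replace (u'' r) with
      (2 * u r ^ 3 + 6 / r * u r ^ 2 + 3 / r ^ 2 * u r - 3 / r * u' r
       + (u' r + u r / r) * h r) by lra.
    field; auto.
Qed.

(** The weight [s] in [D ^ 2 + s q ^ 2] turns the singular damping [- 5 q / s]
    of the reduced equation into [- 10 q ^ 2], which absorbs the cross terms. *)
Lemma difference_energy_bound (D q G L s : R) :
  0 < s -> 0 <= L -> Rabs G <= L * (Rabs D + s * Rabs q) ->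
  2 * D * q + q ^ 2 + 2 * s * q * ((G - 5 * q) / s)
  <= (1 + L) ^ 2 * (D ^ 2 + s * q ^ 2).
Proof.
  intros hs hL hG.
  replace (2 * D * q + q ^ 2 + 2 * s * q * ((G - 5 * q) / s))
    with (2 * (D * q) + 2 * (q * G) - 9 * q ^ 2) by (field; lra).
  assert (e1 : D * q <= Rabs D * Rabs q)
    by (rewrite <- Rabs_mult; apply Rle_abs).
  assert (e2 : q * G <= Rabs q * (L * (Rabs D + s * Rabs q))).
  { apply Rle_trans with (Rabs q * Rabs G);
      [rewrite <- Rabs_mult; apply Rle_abs|].
    apply Rmult_le_compat_l; auto; apply Rabs_pos. }
  rewrite <- (pow2_abs D), <- (pow2_abs q).
  generalize (Rabs_pos D) (Rabs_pos q); intros d0 q0.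
  set (d := Rabs D) in *; set (y := Rabs q) in *.
  assert (0 <= ((1 + L) * d - y) ^ 2) by apply pow2_ge_0.
  assert (0 <= s * y ^ 2) by (apply Rmult_le_pos; [lra | apply pow2_ge_0]).
  assert (0 <= L ^ 2 * (s * y ^ 2))
    by (apply Rmult_le_pos; [apply pow2_ge_0 | auto]).
  generalize (pow2_ge_0 y); nra.
Qed.

Lemma solution_unique (h : R -> R) (alpha : R) (T : Rbar) (u v : R -> R) :
  C0_on (ico p_infty) h ->
  solution h alpha T u -> solution h alpha T v ->
  forall r, ico T r -> u r = v r.
Proof.
  intros hc [hT [u1 [u2 [[du [du1 cu2]] [equ [u0 ua]]]]]].
  intros [_ [v1 [v2 [[dv [dv1 cv2]] [eqv [v0 va]]]]]] b [hb hbT].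
  apply Rle_lt_or_eq_dec in hb; destruct hb as [hb|<-]; [|congruence].
  assert (below : forall s : R, s <= b -> Rbar_lt s T)
    by (intros s hs; apply (Rbar_le_lt_trans s b); auto).
  destruct (C0_on_bounded p_infty h b) as [K [K0 HK]]; simpl; auto; try lra.
  assert (slope : forall w w1 w2, derivative_on (ico T) w w1 ->
    derivative_on (ico T) w1 w2 -> w 0 = 0 ->
    exists B, 0 < B /\ forall s, 0 < s <= b -> Rabs (w s / s) <= B).
  { intros w w1 w2 dw dw1 w0.
    destruct (C0_on_bounded T w1 b) as [B [B0 HB]]; auto; [|lra|].
    { now apply derivative_on_C0 with w2. }
    exists B; split; auto; intros s hs.
    assert (H := increment_on T w w1 B s hT dw w0 ltac:(lra)
                   (below s ltac:(lra))
                   (fun x hx => HB x ltac:(lra))).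
    unfold Rdiv; rewrite Rabs_mult, (Rabs_pos_eq (/ s))
      by (left; apply Rinv_0_lt_compat; lra).
    apply (Rmult_le_reg_r s); [lra|].
    rewrite Rmult_assoc, Rinv_l; lra. }
  destruct (slope u u1 u2 du du1 u0) as [Bu [Bu0 HBu]].
  destruct (slope v v1 v2 dv dv1 v0) as [Bv [Bv0 HBv]].
  assert (d1 := derivative_on_minus _ _ _ _ _ du dv).
  assert (d2 := derivative_on_minus _ _ _ _ _ du1 dv1).
  destruct (C0_on_bounded T u2 b) as [Mu [Mu0 HMu]]; auto; [lra|].
  destruct (C0_on_bounded T v2 b) as [Mv [Mv0 HMv]]; auto; [lra|].
  set (M := Mu + Mv).
  (* The two solutions agree to first order at 0, so with bounded second
     derivatives they differ by a multiple of [s ^ 2] and their slopes by a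
     multiple of [s]. *)
  assert (near1 : forall s, 0 <= s <= b -> Rabs (u1 s - v1 s) <= M * s).
  { intros s hs.
    apply (increment_on T (fun x => u1 x - v1 x) (fun x => u2 x - v2 x));
      auto; try lra.
    - apply below; lra.
    - intros x hx; eapply Rle_trans; [apply Rabs_triang|].
      rewrite Rabs_Ropp; apply Rplus_le_compat; [apply HMu | apply HMv]; lra. }
  assert (near0 : forall s, 0 <= s <= b -> Rabs (u s - v s) <= M * s * s).
  { intros s hs.
    apply (increment_on T (fun x => u x - v x) (fun x => u1 x - v1 x));
      auto; try lra.
    - apply below; lra.
    - intros x hx; eapply Rle_trans; [apply near1; lra|].
      apply Rmult_le_compat_l; unfold M; lra. }
  set (D := fun s => u s / s - v s / s).
  set (q := fun s => (u1 s - u s / s) / s - (v1 s - v s / s) / s).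
  set (B := Rmax Bu Bv).
  set (L := 6 * b ^ 3 * B ^ 2 + 12 * b * B + 2 * K).
  assert (hB : 0 <= B) by (apply Rle_trans with Bu; [lra | apply Rmax_l]).
  assert (hL : 0 <= L).
  { assert (0 <= b ^ 3 * B ^ 2)
      by (apply Rmult_le_pos; [apply pow_le; lra | apply pow2_ge_0]).
    assert (0 <= b * B) by (apply Rmult_le_pos; lra). unfold L; lra. }
  set (C := (1 + L) ^ 2).
  set (E := fun s => D s ^ 2 + s * q s ^ 2).
  set (G := fun s => reduced_rhs (h s) s (u s / s) ((u1 s - u s / s) / s)
                     - reduced_rhs (h s) s (v s / s) ((v1 s - v s / s) / s)).
  set (E' := fun s => 2 * D s * q s + q s ^ 2
                      + 2 * s * q s * ((G s - 5 * q s) / s)).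
  assert (dE : forall s, 0 < s <= b -> is_derive E s (E' s)).
  { intros s hs.
    assert (hsT := below s ltac:(lra)).
    destruct (solution_reduced h u u1 u2 s) as [zu pu]; auto; try lra.
    { apply (derivative_on_interior T); auto; lra. }
    { apply (derivative_on_interior T); auto; lra. }
    { apply equ; auto; lra. }
    destruct (solution_reduced h v v1 v2 s) as [zv pv]; auto; try lra.
    { apply (derivative_on_interior T); auto; lra. }
    { apply (derivative_on_interior T); auto; lra. }
    { apply eqv; auto; lra. }
    assert (dD := is_derive_minus _ _ _ _ _ zu zv).
    assert (dq := is_derive_minus _ _ _ _ _ pu pv).
    change (is_derive D s (q s)) in dD.
    assert (dq' : is_derive q s ((G s - 5 * q s) / s)).
    { refine (eq_rect _ (is_derive q s) dq _ _).
      unfold minus, plus, opp, G, q; simpl; field; lra. }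
    clear dq zu pu zv pv; unfold E, E'.
    clearbody G D q.
    auto_derive; [repeat split; eexists; eassumption|].
    replace (Derive (fun y : R => D y) s) with (q s)
      by (symmetry; exact (is_derive_unique D s _ dD)).
    replace (Derive (fun y : R => q y) s) with ((G s - 5 * q s) / s)
      by (symmetry; exact (is_derive_unique q s _ dq')).
    ring. }
  assert (growth : forall s, 0 < s <= b -> E' s <= C * E s).
  { intros s hs; apply difference_energy_bound; [lra | auto |].
    apply (reduced_rhs_lipschitz (h s) s b B K); [lra | | |].
    - apply HK; lra.
    - eapply Rle_trans; [now apply HBu | apply Rmax_l].
    - eapply Rle_trans; [now apply HBv | apply Rmax_r]. }
  assert (decay : forall e, 0 < e <= b ->
            E b * exp (- C * b) <= E e * exp (- C * e)).
  { intros e he.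
    assert (dEe : forall x, e <= x <= b ->
      is_derive (fun s => E s * exp (- C * s)) x
        ((E' x - C * E x) * exp (- C * x))).
    { intros x hx; assert (dx := dE x ltac:(lra)); clearbody E E' C.
      auto_derive; [now eexists; apply dx|].
      replace (Derive (fun y : R => E y) x) with (E' x)
        by (symmetry; exact (is_derive_unique E x _ dx)).
      ring. }
    apply (nonincreasing_of_derive (fun s => E s * exp (- C * s))
             (fun x => (E' x - C * E x) * exp (- C * x))); [lra|..].
    - intros x hx; exact (is_derive_cpt _ _ _ (dEe x hx)).
    - intros x hx; apply dEe; lra.
    - intros x hx; generalize (growth x ltac:(lra)) (exp_pos (- C * x)); nra. }
  (* [q] is only known to be bounded at the origin; the weight [s] of [q ^ 2] is
     what makes the energy tend to 0. *)
  assert (start : forall e, 0 < e <= b -> E e <= (b + 4) * M ^ 2 * e).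
  { intros e he.
    assert (iE : / e * e = 1) by (apply Rinv_l; lra).
    assert (hD : Rabs (D e) <= M * e).
    { replace (D e) with ((u e - v e) / e) by (unfold D; field; lra).
      unfold Rdiv; rewrite Rabs_mult, (Rabs_pos_eq (/ e))
        by (left; apply Rinv_0_lt_compat; lra).
      apply (Rmult_le_reg_r e); [lra|].
      rewrite Rmult_assoc, iE, Rmult_1_r; apply near0; lra. }
    assert (hq : Rabs (q e) <= 2 * M).
    { replace (q e) with ((u1 e - v1 e - D e) / e) by (unfold q, D; field; lra).
      unfold Rdiv; rewrite Rabs_mult, (Rabs_pos_eq (/ e))
        by (left; apply Rinv_0_lt_compat; lra).
      apply (Rmult_le_reg_r e); [lra|].
      rewrite Rmult_assoc, iE, Rmult_1_r.
      eapply Rle_trans; [apply Rabs_triang|].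
      rewrite Rabs_Ropp; generalize (near1 e ltac:(lra)); lra. }
    unfold E; rewrite <- (pow2_abs (D e)), <- (pow2_abs (q e)).
    assert (Rabs (D e) ^ 2 <= (M * e) ^ 2)
      by (apply pow_incr; split; [apply Rabs_pos | auto]).
    assert (Rabs (q e) ^ 2 <= (2 * M) ^ 2)
      by (apply pow_incr; split; [apply Rabs_pos | auto]).
    assert (0 <= M ^ 2 * e) by (apply Rmult_le_pos; [apply pow2_ge_0 | lra]).
    nra. }
  assert (Eb : E b <= 0).
  { destruct (Rle_lt_dec (E b) 0) as [|hpos]; auto; exfalso.
    assert (x0 : 0 < E b * exp (- C * b))
      by (apply Rmult_lt_0_compat; [auto | apply exp_pos]).
    assert (m0 : 0 < (b + 4) * M ^ 2)
      by (apply Rmult_lt_0_compat; [lra | apply pow_lt; unfold M; lra]).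
    set (x := E b * exp (- C * b)) in *.
    set (m := (b + 4) * M ^ 2) in *.
    assert (e0 : 0 < Rmin b (x / (2 * m))).
    { apply Rmin_glb_lt; auto; apply Rdiv_lt_0_compat; lra. }
    set (e := Rmin b (x / (2 * m))) in *.
    assert (eb : e <= b) by apply Rmin_l.
    assert (ex : e <= x / (2 * m)) by apply Rmin_r.
    specialize (decay e ltac:(lra)); specialize (start e ltac:(lra)).
    assert (c0 : 0 <= C) by apply pow2_ge_0.
    assert (exp (- C * e) <= 1).
    { rewrite <- exp_0; apply exp_nondecreasing; nra. }
    assert (m * e <= m * (x / (2 * m))) by (apply Rmult_le_compat_l; lra).
    replace (m * (x / (2 * m))) with (x / 2) in * by (field; lra).
    assert (0 <= E e).
    { unfold E; generalize (pow2_ge_0 (D e)) (pow2_ge_0 (q e)); nra. }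
    generalize (exp_pos (- C * e)); nra. }
  assert (Db : D b = 0).
  { unfold E in Eb; generalize (pow2_ge_0 (D b)) (pow2_ge_0 (q b)); intros.
    assert (0 <= b * q b ^ 2) by (apply Rmult_le_pos; lra).
    assert (D b ^ 2 = 0) by lra. nra. }
  unfold D in Db.
  replace (u b) with (b * (u b / b)) by (field; lra).
  replace (u b / b) with (v b / b) by lra.
  field; lra.
Qed.

(** * The theorem *)

Lemma solution_restrict (h : R -> R) (alpha : R) (T : Rbar) (u : R -> R) :
  Rbar_lt 0 T -> global_solution h alpha u -> solution h alpha T u.
Proof.
  intros hT [_ [u1 [u2 [[d [d1 c2]] [eq ic]]]]].
  assert (sub : forall x, ico T x -> ico p_infty x)
    by (intros x [hx _]; split; [auto | exact I]).
  assert (res : forall x f l y, limit1_in f (D_x (ico p_infty) x) l y ->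
                  limit1_in f (D_x (ico T) x) l y).
  { intros x f l y H eps he; destruct (H eps he) as [a [ha Ha]].
    exists a; split; auto; intros s [[hs hne] hd]; apply Ha.
    split; [split; [now apply sub | auto] | auto]. }
  split; auto; exists u1, u2; split; [split; [|split]|split]; auto.
  - intros x hx; apply res, d; auto.
  - intros x hx; apply res, d1; auto.
  - intros x hx; apply res, c2; auto.
  - intros r hr _; apply eq; [auto | exact I].
Qed.

Lemma initial_slope_unique (h : R -> R) (alpha beta : R) (u v : R -> R) :
  global_solution h alpha u -> global_solution h beta v ->
  (forall r, 0 <= r -> u r = v r) -> alpha = beta.
Proof.
  intros [_ [u1 [u2 [[du _] [_ [_ <-]]]]]] [_ [v1 [v2 [[dv _] [_ [_ <-]]]]]] e.
  assert (h0 : ico p_infty 0) by (split; [lra | exact I]).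
  apply (single_limit (fun x => (u x - u 0) / (x - 0)) (D_x (ico p_infty) 0)
           (u1 0) (v1 0) 0).
  - intros a ha; exists (a / 2); split; [split; [split; [lra | exact I] | lra]|].
    unfold Rdist; rewrite Rabs_pos_eq; lra.
  - exact (du 0 h0).
  - intros eps he; destruct (dv 0 h0 eps he) as [a [ha Ha]].
    exists a; split; auto; intros x hx.
    rewrite (e x), (e 0) by (lra || apply hx); auto.
Qed.

Theorem theorem5p1 (h : R -> R)
  (h_cont : C0_on (ico p_infty) h)
  (h_npos : forall r : R, 0 < r -> h r <= 0) :
  (exists U : nat -> R -> R,
     (forall n : nat, negative_global_solution h (U n)) /\
     (forall n m : nat, n <> m -> exists r : R, 0 <= r /\ U n r <> U m r)) /\
  (forall alpha : R, alpha < 0 ->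
     exists u : R -> R,
       is_the_global_solution h alpha u /\
       forall r : R, 0 < r -> - (2 / r) < u r < 0).
Proof.
  split.
  - assert (ex : forall n : nat, exists u, global_solution h (- INR (S n)) u /\
                   forall r, 0 < r -> - (2 / r) < u r < 0).
    { intros n; apply global_solution_exists; auto.
      generalize (lt_0_INR (S n) (Nat.lt_0_succ n)); lra. }
    set (U := fun n =>
      proj1_sig (constructive_indefinite_description _ (ex n))).
    assert (hU : forall n, global_solution h (- INR (S n)) (U n) /\
                   forall r, 0 < r -> - (2 / r) < U n r < 0).
    { intros n; exact (proj2_sig (constructive_indefinite_description _ (ex n))). }
    clearbody U; exists U; split.
    + intros n; destruct (hU n) as [hu bd].
      split; [now exists (- INR (S n)) | intros r hr; now apply bd].
    + intros n m hnm; apply NNPP; intros hno; apply hnm.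
      assert (e : - INR (S n) = - INR (S m)).
      { apply (initial_slope_unique h _ _ (U n) (U m));
          [apply hU | apply hU |]; intros r hr.
        apply NNPP; intros hne; apply hno; now exists r. }
      apply Ropp_eq_compat in e; rewrite !Ropp_involutive in e.
      apply INR_eq in e; lia.
  - intros alpha ha.
    destruct (global_solution_exists h alpha) as [u [hu bd]]; auto.
    exists u; split; [split; [exact hu|] | exact bd].
    intros T v hv r hr.
    apply (solution_unique h alpha T v u); auto.
    apply solution_restrict; [apply hv | exact hu].
Qed.
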